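(* Let $n \ge 1$ and let $x_1 < x_2 < \cdots < x_n$ and $y_1 < y_2 < \cdots < y_n$ be real numbers. Let $A$ be the $n\times n$ matrix $A = [e^{x_i y_j}]_{i,j=1,\ldots,n}$. Then $$\det(A) \ge \frac{1}{c_n} V(\mathbf{x}) V(\mathbf{y})\, e^{(x_1+\cdots+x_n)(y_1+\cdots+y_n)/n}$$ and $$\det(A) \le \frac{1}{c_n} V(\mathbf{x}) V(\mathbf{y})\, e^{x_1y_1+\cdots+x_ny_n}.$$
   Context: For $\mathbf{x}=(x_1,\ldots,x_n)$, $V(\mathbf{x}) := \prod_{1\le i<j\le n}(x_j-x_i)$ denotes the Vandermonde polynomial (equal to $1$ when $n=1$), and similarly $V(\mathbf{y})=\prod_{1\le i<j\le n}(y_j-y_i)$. The constant $c_n$ is $c_n := \prod_{i=1}^{n-1} (i!)$ (with $c_1=1$). *)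

(* Defs.v *)
From HB Require Import structures.
From mathcomp Require Import all_boot all_order all_algebra.
From mathcomp Require Import all_classical all_reals all_analysis.
Set Implicit Arguments. Unset Strict Implicit. Unset Printing Implicit Defensive.
Import Order.TTheory GRing.Theory Num.Theory.
Local Open Scope ring_scope.

Definition vandermonde {R : pzRingType} (n : nat) (x : 'I_n -> R) : R :=
  \prod_(i < n) \prod_(j < n | (i < j)%N) (x j - x i).

Definition cn (n : nat) : nat := \prod_(1 <= i < n) i`!.

Definition expmx {R : realType} (n : nat) (x y : 'I_n -> R) : 'M[R]_n :=
  \matrix_(i < n, j < n) expR (x i * y j).

(* Main.v *)
(* Subtracting y_1 from every y_j multiplies det A and both bounds by the same
   factor, so one may take y_1 = 0.  Differencing consecutive rows then writes
   det[e^(x_i y_j)] as prod_(j>1) y_j times the integral of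
   det[e^(z_i y_(j+1))], of size n-1, over the z interlacing x, i.e.
   x_i <= z_i <= x_(i+1).  The same device gives
     int V(z) dz = V(x) / (n-1)!,
     int V(z) (sum z) dz = V(x) (sum x) / ((n-2)! n).
   By induction the upper bound follows from z_i <= x_(i+1), and the lower one
   from Jensen's inequality for the density V(z).
   All integrands are combinations of determinants whose i-th row depends on
   z_i only, so multiple integrals are avoided: inequalities are integrated one
   row at a time by the mean value theorem. *)

Require Import Defs.
From HB Require Import structures.
From mathcomp Require Import all_boot all_order all_algebra.
From mathcomp Require Import all_classical all_reals all_analysis.
From mathcomp Require Import ring.
Import Order.TTheory GRing.Theory Num.Theory.
Local Open Scope ring_scope.

(** * Determinants under row and column operations *)

Lemma det_scale_cols (R : comPzRingType) n (A : 'M[R]_n) (d : 'I_n -> R) :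
  \det (\matrix_(i, j) (d j * A i j)) = (\prod_j d j) * \det A.
Proof.
rewrite mulrC.
have -> : \prod_j d j = \det (diag_mx (\row_j d j)).
  by rewrite det_diag; apply: eq_bigr => j _; rewrite mxE.
rewrite -det_mulmx; congr (\det _).
by apply/matrixP => i j; rewrite mul_mx_diag !mxE mulrC.
Qed.

Lemma det_scale_rows (R : comPzRingType) n (A : 'M[R]_n) (d : 'I_n -> R) :
  \det (\matrix_(i, j) (d i * A i j)) = (\prod_i d i) * \det A.
Proof.
rewrite -det_tr -(det_tr A) -det_scale_cols; congr (\det _).
by apply/matrixP => i j; rewrite !mxE.
Qed.

(** Left multiplication by the unipotent bidiagonal [L] subtracts from each row the one above it.
    The first column becomes (1, 0, ..., 0), and expanding along it leaves one minor. *)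
Lemma det_col1 (R : comNzRingType) m (A : 'M[R]_m.+1) :
  (forall i, A i ord0 = 1) ->
  \det A = \det (\matrix_(i < m, j < m)
    (A (lift ord0 i) (lift ord0 j) - A (widen_ord (leqnSn m) i) (lift ord0 j))).
Proof.
move=> A1.
pose L : 'M[R]_m.+1 := \matrix_(i, k) ((i == k)%:R - (i == k.+1 :> nat)%:R).
have detL : \det L = 1.
  rewrite det_trig; last first.
    apply/is_trig_mxP => i k ik; rewrite mxE -val_eqE /=.
    by rewrite (ltn_eqF ik) (ltn_eqF (leqW ik)) subrr.
  by rewrite big1 // => i _; rewrite mxE eqxx (ltn_eqF (ltnSn i)) subr0.
have LA0 j : (L *m A) ord0 j = A ord0 j.
  rewrite mxE (bigD1 ord0) //= big1 ?mxE /= => [|k k0].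
    by rewrite subr0 mul1r addr0.
  by rewrite mxE eq_sym (negPf k0) subr0 mul0r.
have LAS i j : (L *m A) (lift ord0 i) j =
    A (lift ord0 i) j - A (widen_ord (leqnSn m) i) j.
  rewrite mxE.
  under eq_bigr do rewrite mxE mulrBl.
  rewrite sumrB; congr (_ - _).
    rewrite (bigD1 (lift ord0 i)) //= eqxx mul1r big1 ?addr0 // => k ki.
    by rewrite eq_sym (negPf ki) mul0r.
  rewrite (bigD1 (widen_ord (leqnSn m) i)) //= eqxx mul1r big1 ?addr0 // => k ki.
  by rewrite eqSS -(inj_eq val_inj) eq_sym /= in ki *; rewrite (negPf ki) mul0r.
transitivity (\det (L *m A)); first by rewrite det_mulmx detL mul1r.
rewrite (expand_det_col _ ord0) big_ord_recl big1 ?addr0; last first.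
  by move=> i _; rewrite LAS !A1 subrr mul0r.
rewrite LA0 A1 mul1r /cofactor addn0 expr0 mul1r; congr (\det _).
by apply/matrixP => i j; rewrite mxE [in LHS]mxE LAS mxE.
Qed.

(** * Vandermonde determinants *)

Lemma vandermondeE (R : comPzRingType) n (x : 'I_n -> R) :
  vandermonde x = \det (\matrix_(i, j) (x i ^+ j)).
Proof.
transitivity (\det (Vandermonde n (\row_j x j))).
  rewrite det_Vandermonde.
  by apply: eq_bigr => i _; apply: eq_bigr => j _; rewrite !mxE.
by rewrite -det_tr; congr (\det _); apply/matrixP => i j; rewrite !mxE.
Qed.

Lemma vandermonde_recl (R : pzRingType) m (x : 'I_m.+1 -> R) :
  vandermonde x =
  (\prod_(j < m) (x (lift ord0 j) - x ord0)) * vandermonde (x \o lift ord0).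
Proof.
rewrite /vandermonde big_ord_recl; congr (_ * _).
  by rewrite big_mkcond big_ord_recl /= mul1r.
apply: eq_bigr => i _.
by rewrite big_mkcond big_ord_recl /= mul1r [in RHS]big_mkcond.
Qed.

Lemma vandermonde_ge0 (R : realType) n (x : 'I_n -> R) :
  (forall i j : 'I_n, (i < j)%N -> x i <= x j) -> 0 <= vandermonde x.
Proof.
by move=> xi; apply: prodr_ge0 => i _; apply: prodr_ge0 => j ij; rewrite subr_ge0 xi.
Qed.

(* The last columns x_i^(m+1) are obtained from the Vandermonde matrix by
   multiplying it by the companion matrix of [\prod_i ('X - x_i)]. *)
Lemma vandermondeM_sum (R : idomainType) m (x : 'I_m.+1 -> R) :
  vandermonde x * (\sum_i x i) =
  \det (\matrix_(i, j) (x i ^+ (j + (j == ord_max)))).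
Proof.
pose p : {poly R} := \prod_(a <- codom x) ('X - a%:P).
have szx : size (codom x) = m.+1 by rewrite size_codom card_ord.
have szp : size p = m.+2 by rewrite size_prod_XsubC szx.
have pm : p`_m = - \sum_i x i.
  have := coefPn_prod_XsubC (ps := codom x); rewrite szx /= => -> //.
  by rewrite big_map big_enum.
have pmon : p`_m.+1 = 1.
  by have /monicP := monic_prod_XsubC (codom x) predT id; rewrite lead_coefE -/p szp.
have px i : x i ^+ m.+1 = - \sum_(k < m.+1) p`_k * x i ^+ k.
  have /rootP : root p (x i) by rewrite /p root_prod_XsubC codom_f.
  rewrite horner_coef szp big_ord_recr /= pmon mul1r.
  by move/eqP; rewrite addr_eq0 => /eqP ->; rewrite opprK.
(* Only the last column differs from the identity, so [N] is triangular and its determinant is its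
   corner entry, the sum of the [x i]. *)
pose N : 'M[R]_m.+1 := \matrix_(k, j) (if j == ord_max then - p`_k else (k == j)%:R).
have detN : \det N = \sum_i x i.
  rewrite -det_tr det_trig; last first.
    apply/is_trig_mxP => i j ij; rewrite !mxE ifF; last first.
      by apply/negP => /eqP im; rewrite im ltnNge -ltnS ltn_ord in ij.
    by rewrite -val_eqE /= gtn_eqF.
  rewrite big_ord_recr /= big1 ?mul1r => [|i _].
    by rewrite !mxE eqxx pm opprK.
  by rewrite !mxE eqxx -val_eqE /= ltn_eqF.
rewrite vandermondeE -detN -det_mulmx; congr (\det _).
apply/matrixP => i j; rewrite !mxE; case: (eqVneq j ord_max) => [->|jm].
  rewrite addn1 px -sumrN; apply: eq_bigr => k _.
  by rewrite !mxE eqxx mulrN mulrC.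
rewrite addn0 (bigD1 j) //= !mxE (negPf jm) eqxx mulr1 big1 ?addr0 // => k kj.
by rewrite !mxE (negPf jm) (negPf kj) mulr0.
Qed.

(** * Integrating determinant inequalities row by row *)

Lemma is_derive_bigsum (R : realType) (I : finType) (h : I -> R -> R)
    (dh : I -> R) (t : R) :
  (forall i, is_derive t 1 (h i) (dh i)) ->
  is_derive t 1 (fun u => \sum_i h i u) (\sum_i dh i).
Proof.
move=> dhP.
have -> : (fun u => \sum_i h i u) = \sum_i h i by apply/funext => u; rewrite fct_sumE.
by elim/big_ind2 : _ => // *; [exact: is_derive_cst|exact: is_deriveD].
Qed.

(* Each step integrates one row by the mean value theorem, the determinants
   being linear in that row. *)
Lemma det_box_ge0 (R : realType) (K : finType) m (c : K -> R)
    (F f : K -> 'I_m -> R -> R) (a b : 'I_m -> R) :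
  (forall i, a i <= b i) ->
  (forall k j (z : R), is_derive z 1 (F k j) (f k j z)) ->
  (forall z : 'I_m -> R, (forall i, a i <= z i <= b i) ->
     0 <= \sum_k c k * \det (\matrix_(i, j) f k j (z i))) ->
  0 <= \sum_k c k * \det (\matrix_(i, j) (F k j (b i) - F k j (a i))).
Proof.
move=> ab dF f0.
(* Rows of index less than [p] are already integrated, the others still evaluated at [z]. *)
pose M p (z : 'I_m -> R) k : 'M[R]_m := \matrix_(i, j)
  if (i < p)%N then F k j (b i) - F k j (a i) else f k j (z i).
suff MP p : (p <= m)%N -> forall z : 'I_m -> R, (forall i, a i <= z i <= b i) ->
    0 <= \sum_k c k * \det (M p z k).
  have := MP m (leqnn m) a.
  rewrite (eq_bigr (fun k => c k * \det (\matrix_(i, j) (F k j (b i) - F k j (a i))))).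
    by apply=> i; rewrite lexx ab.
  by move=> k _; congr (_ * \det _); apply/matrixP => i j; rewrite !mxE ltn_ord.
elim: p => [_ z zab|p IH pm z zab].
  by rewrite (eq_bigr (fun k => c k * \det (\matrix_(i, j) f k j (z i)))) ?f0 //.
pose q := Ordinal pm.
(* Cofactors along row [q] ignore that row, so they stay constant while [z q] varies: [G] below is a
   primitive of [g]. *)
pose C k j := cofactor (M p z k) q j.
pose G t := \sum_k c k * \sum_j F k j t * C k j.
pose g t := \sum_k c k * \sum_j f k j t * C k j.
have CE k j (A : 'M[R]_m) : (forall i j', i != q -> A i j' = M p z k i j') ->
    cofactor A q j = C k j.
  move=> AM; rewrite /C /cofactor; congr (_ * \det _).
  by apply/matrixP => i j'; rewrite !mxE AM ?mxE // eq_sym neq_lift.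
have gE t : a q <= t <= b q -> 0 <= g t.
  move=> tab; pose zt i := if i == q then t else z i.
  have /(IH (ltnW pm)) : forall i, a i <= zt i <= b i.
    by move=> i; rewrite /zt; case: eqP => [->|].
  congr (_ <= _); apply: eq_bigr => k _; congr (_ * _).
  rewrite (expand_det_row _ q); apply: eq_bigr => j _; congr (_ * _).
    by rewrite mxE /= ltnn /zt eqxx.
  by apply: CE => i j' iq; rewrite !mxE /zt (negPf iq).
have GE : \sum_k c k * \det (M p.+1 z k) = G (b q) - G (a q).
  rewrite /G -sumrB; apply: eq_bigr => k _; rewrite -mulrBr; congr (_ * _).
  rewrite (expand_det_row _ q) -sumrB; apply: eq_bigr => j _; rewrite -mulrBl.
  congr (_ * _); first by rewrite mxE /= ltnSn.
  apply: CE => i j' iq; rewrite !mxE ltnS leq_eqVlt.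
  by rewrite -val_eqE /= in iq; rewrite (negPf iq).
have dG (t : R) : is_derive t 1 G (g t).
  apply: is_derive_bigsum => k; apply: is_deriveZ; apply: is_derive_bigsum => j.
  have -> : (fun u => F k j u * C k j) = C k j \*: F k j.
    by apply/funext => u; rewrite mulrC.
  by rewrite mulrC; apply: is_deriveZ.
have [|t tab Gt] := MVT_segment (ab q) (fun t _ => dG t).
  by apply: derivable_within_continuous => t _; exact: ex_derive.
by rewrite GE Gt mulr_ge0 ?subr_ge0 // gE.
Qed.

(** * Integration over interlacing points *)

Lemma prod_succ (R : comPzRingType) m : \prod_(j < m) j.+1%:R = m`!%:R :> R.
Proof. by rewrite fact_prod big_add1 /= big_mkord natr_prod. Qed.

(** These are the factors produced by differentiating the powers 1, ..., m and m+2 of a variable, as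
    happens for the determinant of [vandermondeM_sum]. *)
Lemma prod_succ_bump (R : comPzRingType) m :
  \prod_(j < m.+1) (j + (j == ord_max)).+1%:R = (m`! * m.+2)%:R :> R.
Proof.
rewrite big_ord_recr /= eqxx addn1 natrM -prod_succ; congr (_ * _).
by apply: eq_bigr => j _; rewrite -val_eqE /= ltn_eqF ?addn0.
Qed.

Lemma is_derive_expRM (R : realType) (t z : R) :
  is_derive z 1 (fun z => expR (z * t)) (t * expR (z * t)).
Proof.
have -> : (fun z => expR (z * t)) = expR \o (t \*: id).
  by apply/funext => u /=; rewrite mulrC.
apply: is_derive_eq.
by rewrite /= mulrC (mulrC z) /GRing.scale /= mulr1.
Qed.

Lemma is_derive_expn (R : realType) n (z : R) :
  is_derive z 1 (fun z => z ^+ n.+1) (n.+1%:R * z ^+ n).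
Proof.
have -> : (fun z : R => z ^+ n.+1) = id ^+ n.+1.
  by apply/funext => u; rewrite fctE.
by apply: is_derive_eq; rewrite /GRing.scale /= mulr1.
Qed.

(* The hypothesis is integrated over all [z] interlacing [x]: the three terms
   are determinants with rows in [z_i], and their antiderivatives, differenced
   along [x], are again such determinants by [det_col1]. *)
Lemma interlace_ge0 (R : realType) m (x u : 'I_m.+2 -> R) (a b c : R) :
  u ord0 = 0 -> (forall i j : 'I_m.+2, (i < j)%N -> x i <= x j) ->
  (forall z : 'I_m.+1 -> R,
     (forall i, x (widen_ord (leqnSn m.+1) i) <= z i <= x (lift ord0 i)) ->
     0 <= a * ((\prod_j u (lift ord0 j)) * \det (expmx z (u \o lift ord0))) +
          b * vandermonde z + c * (vandermonde z * \sum_i z i)) ->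
  0 <= a * \det (expmx x u) + b / m.+1`!%:R * vandermonde x +
       c / (m`! * m.+2)%:R * (vandermonde x * \sum_i x i).
Proof.
move=> u0 xi H.
have fn0 n : n`!%:R != 0 :> R by rewrite pnatr_eq0 -lt0n fact_gt0.
have sum3 (h : 'I_3 -> R) : \sum_k h k =
    h ord0 + (h (lift ord0 ord0) + h (lift ord0 (lift ord0 ord0))).
  by rewrite !big_ord_recl big_ord0 addr0.
pose cc (k : 'I_3) := match val k with
  0 => a | 1 => b / m.+1`!%:R | _ => c / (m`! * m.+2)%:R end.
(* The last exponent is raised only for [k] = 2, the term with the sum of the [z i]. *)
pose e (k : nat) (j : 'I_m.+1) := (j + (k == 2) * (j == ord_max))%N.
pose F (k : 'I_3) (j : 'I_m.+1) z := if val k is k'.+1 then z ^+ (e k j).+1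
  else expR (z * u (lift ord0 j)).
pose f (k : 'I_3) (j : 'I_m.+1) z := if val k is k'.+1 then (e k j).+1%:R * z ^+ e k j
  else u (lift ord0 j) * expR (z * u (lift ord0 j)).
have := @det_box_ge0 R _ m.+1 cc F f (x \o widen_ord (leqnSn m.+1)) (x \o lift ord0).
have -> : \sum_k cc k * \det (\matrix_(i < m.+1, j < m.+1)
   (F k j ((x \o lift ord0) i) - F k j ((x \o widen_ord (leqnSn m.+1)) i)))
  = a * \det (expmx x u) + b / m.+1`!%:R * vandermonde x +
       c / (m`! * m.+2)%:R * (vandermonde x * \sum_i x i).
  rewrite sum3 addrA /cc /=.
  rewrite vandermondeM_sum vandermondeE !(@det_col1 _ m.+1); first last.
  1-3: by move=> i; rewrite mxE ?u0 ?mulr0 ?expR0.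
  congr (_ * _ + _ * _ + _ * _); congr (\det _); apply/matrixP => i j; rewrite !mxE //.
  + by rewrite /F /e /= mul0n addn0.
  + by rewrite /F /e /= mul1n.
apply.
- by move=> i; apply: xi; rewrite /= /bump.
- move=> k j z; rewrite /F /f; case: k => [[|k] kk] /=.
    exact: is_derive_expRM.
  exact: is_derive_expn.
- move=> z zx; have := H z zx; congr (_ <= _).
  rewrite sum3 addrA /cc /=.
  congr (_ + _ + _).
  + rewrite -det_scale_cols; congr (_ * \det _).
    by apply/matrixP => i j; rewrite !mxE.
  + rewrite -[_ / _ * _]mulrA; congr (_ * _).
    rewrite vandermondeE -[LHS](mulKf (fn0 m.+1)) -[in RHS]prod_succ -prod_succ; congr (_ * _).
    rewrite -det_scale_cols; congr (\det _).
    by apply/matrixP => i j; rewrite !mxE /f /e /= mul0n addn0.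
  + have n0 : (m`! * m.+2)%:R != 0 :> R by rewrite natrM mulf_neq0 ?fn0 ?pnatr_eq0.
    rewrite -[_ / _ * _]mulrA; congr (_ * _).
    rewrite vandermondeM_sum -[LHS](mulKf n0) -!prod_succ_bump; congr (_ * _).
    rewrite -det_scale_cols; congr (\det _).
    by apply/matrixP => i j; rewrite !mxE /f /e /= mul1n.
Qed.

(** * The induction on the size *)

(** The hypotheses are weak inequalities because the induction applies to interlacing points [z],
    which may coincide. *)
Lemma exp_det_bounds (R : realType) m (x u : 'I_m.+1 -> R) :
  (forall i j : 'I_m.+1, (i < j)%N -> x i <= x j) ->
  (forall i j : 'I_m.+1, (i < j)%N -> u i <= u j) ->
  (cn m.+1)%:R^-1 * vandermonde x * vandermonde u
      * expR ((\sum_i x i) * (\sum_i u i) / m.+1%:R)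
    <= \det (expmx x u)
    <= (cn m.+1)%:R^-1 * vandermonde x * vandermonde u
      * expR (\sum_i x i * u i).
Proof.
elim: m x u => [|m IH] x u xi ui.
  have V1 (z : 'I_1 -> R) : vandermonde z = 1.
    by rewrite /vandermonde big1 // => i _; rewrite big1 // => j; rewrite !ord1.
  rewrite det_mx11 mxE !big_ord1 divr1 /cn big_geq // !V1 !mulr1 invr1 !mul1r.
  by rewrite lexx.
wlog u0 : u ui / u ord0 = 0.
  move=> /(_ (fun i => u i - u ord0)).
  have -> : \sum_i (u i - u ord0) = (\sum_i u i) - m.+2%:R * u ord0.
    by rewrite sumrB sumr_const card_ord mulr_natl.
  have -> : vandermonde (fun i => u i - u ord0) = vandermonde u.
    by do 2!apply: eq_bigr => ? _; ring.
  have -> : \sum_i x i * (u i - u ord0) = \sum_i x i * u i - (\sum_i x i) * u ord0.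
    by rewrite mulr_suml -sumrB; apply: eq_bigr => i _; rewrite mulrBr.
  have -> : \det (expmx x (fun i => u i - u ord0)) =
      expR (- ((\sum_i x i) * u ord0)) * \det (expmx x u).
    rewrite -mulNr -sumrN mulr_suml expR_sum -det_scale_rows; congr (\det _).
    by apply/matrixP => i j; rewrite !mxE -expRD; congr expR; ring.
  have -> : (\sum_i x i) * (\sum_i u i - m.+2%:R * u ord0) / m.+2%:R =
     - ((\sum_i x i) * u ord0) + (\sum_i x i) * (\sum_i u i) / m.+2%:R.
    have m0 : m.+2%:R != 0 :> R by rewrite pnatr_eq0. by field.
  rewrite (addrC (\sum_i x i * u i)) !expRD.
  rewrite !(mulrCA _ (expR (- _))) !ler_pM2l ?expR_gt0 //; apply => //.
    by move=> i j ij; rewrite lerD2r ui.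
  by rewrite subrr.
pose t : 'I_m.+1 -> R := u \o lift ord0.
have t0 j : 0 <= t j by rewrite -u0 ui.
have ti (i j : 'I_m.+1) : (i < j)%N -> t i <= t j by move=> ij; apply: ui; rewrite /= /bump !add1n ltnS.
pose P := \prod_j t j.
have P0 : 0 <= P by apply: prodr_ge0.
(* Multiplied by [P], both bounds for [z] and [t] become [C * vandermonde z] times an
   exponential. *)
pose C := (cn m.+1)%:R^-1 * vandermonde t * P.
have Vt0 : 0 <= vandermonde t by apply: vandermonde_ge0.
have C0 : 0 <= C by rewrite !mulr_ge0 ?invr_ge0.
have Vu : vandermonde u = P * vandermonde t.
  by rewrite vandermonde_recl; congr (_ * _); apply: eq_bigr => j _; rewrite u0 subr0.
have fn0 n : n`!%:R != 0 :> R by rewrite pnatr_eq0 -lt0n fact_gt0.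
have cn0 n : (cn n)%:R != 0 :> R.
  by rewrite /cn natr_prod prodf_seq_neq0; apply/allP => i _; rewrite fn0 implybT.
have CE : (cn m.+2)%:R^-1 * vandermonde x * vandermonde u = C / m.+1`!%:R * vandermonde x.
  rewrite Vu /C {1}/cn big_nat_recr //= natrM -/(cn m.+1).
  by field; rewrite fn0 cn0.
rewrite CE.
have sumu : \sum_i u i = \sum_i t i by rewrite big_ord_recl u0 add0r.
have zinc (z : 'I_m.+1 -> R) :
    (forall i, x (widen_ord (leqnSn m.+1) i) <= z i <= x (lift ord0 i)) ->
    forall i j : 'I_m.+1, (i < j)%N -> z i <= z j.
  move=> zx i j ij; have /andP[_ zi] := zx i; have /andP[zj _] := zx j.
  apply: le_trans zi (le_trans _ zj).
  (* If j = i+1, both sides are the same entry of [x]; otherwise the monotonicity of [x] applies. *)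
  have [->//|/eqP] := eqVneq (lift ord0 i) (widen_ord (leqnSn m.+1) j).
  move=> ne; apply: xi; rewrite ltn_neqAle /= /bump add1n ij andbT.
  by apply/eqP => ne'; apply: ne; apply: val_inj.
apply/andP; split.
- pose s := (\sum_i t i) / m.+1%:R.
  (* The mean of the sum of the [z i] under the density V(z): the quotient of the two integrals of
     V. *)
  pose mu := m.+1%:R / m.+2%:R * \sum_i x i.
  pose E := C * expR (s * mu).
  (* The last two coefficients encode minus the tangent, [- E * (1 + s * (\sum_i z i - mu))]. *)
  have := @interlace_ge0 R m x u 1 (- E * (1 - s * mu)) (- E * s) u0 xi.
  have M0 : m.+2%:R != 0 :> R by rewrite pnatr_eq0.
  have M1 : m.+1%:R != 0 :> R by rewrite pnatr_eq0.
  have -> : (\sum_i x i) * (\sum_i u i) / m.+2%:R = s * mu.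
    rewrite sumu /s /mu; move: (m.+2%:R) (m.+1%:R) M0 M1 => p q p0 q0.
    by field; rewrite p0 q0.
  (* By the choice of [mu], the two terms in [s] outside the exponential cancel after
     integration. *)
  have -> : 1 * \det (expmx x u) + - E * (1 - s * mu) / m.+1`!%:R * vandermonde x +
      - E * s / (m`! * m.+2)%:R * (vandermonde x * \sum_i x i) =
      \det (expmx x u) - C / m.+1`!%:R * vandermonde x * expR (s * mu).
    rewrite factS !natrM /E /mu; move: (expR _) => w.
    move: (m.+2%:R) (m.+1%:R) (m`!%:R) M0 M1 (fn0 m) => p q r p0 q0 r0.
    by field; rewrite p0 q0 r0.
  rewrite subr_ge0; apply => z zx.
  have /andP[/(ler_wpM2l P0) lb _] := IH z t (zinc z zx) ti.
  rewrite mul1r -addrA -[X in _ + X]opprK subr_ge0; apply: le_trans lb.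
  have -> : P * ((cn m.+1)%:R^-1 * vandermonde z * vandermonde t *
      expR ((\sum_i z i) * (\sum_i t i) / m.+1%:R)) =
      C * vandermonde z * (expR (s * mu) * expR (s * (\sum_i z i - mu))).
    rewrite -expRD -mulrDr addrC subrK -[_ * _ / _]mulrA -/s.
    by rewrite [_ * s]mulrC /C; ring.
  have Vz0 : 0 <= vandermonde z by apply: vandermonde_ge0; exact: zinc.
  (* Jensen's inequality, through the tangent of exp at the barycentre [mu] of
     [\sum_i z i] under the density V(z); it keeps the lower bound of the form
     handled by [interlace_ge0]. *)
  have := expR_ge1Dx (s * (\sum_i z i - mu)).
  move=> /(ler_wpM2l (expR_ge0 (s * mu))) /(ler_wpM2l (mulr_ge0 C0 Vz0)).
  by congr (_ <= _); rewrite /E; ring.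
- pose E := C * expR (\sum_i x i * u i).
  (* Here the exponential is bounded by its value at the upper ends, a constant [E], so no sum term
     is needed. *)
  have := @interlace_ge0 R m x u (-1) E 0 u0 xi.
  rewrite !mul0r addr0 mulN1r addrC subr_ge0 /E => H.
  apply: le_trans (H _) _; last by rewrite le_eqVlt; apply/orP; left; apply/eqP; ring.
  move=> z zx; rewrite !mul0r addr0 mulN1r addrC subr_ge0.
  have /andP[_ /(ler_wpM2l P0) ub] := IH z t (zinc z zx) ti.
  apply: le_trans ub _.
  have -> : P * ((cn m.+1)%:R^-1 * vandermonde z * vandermonde t *
      expR (\sum_i z i * t i)) = C * vandermonde z * expR (\sum_i z i * t i).
    by rewrite /C; ring.
  rewrite [leRHS]mulrAC ler_wpM2l ?mulr_ge0 ?vandermonde_ge0 //; first exact: zinc.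
  (* The term of index 0 vanishes with [u ord0]; the others compare since [t] is nonnegative. *)
  rewrite ler_expR [leRHS]big_ord_recl u0 mulr0 add0r; apply: ler_sum => i _.
  by rewrite ler_wpM2r // ; have /andP[] := zx i.
Qed.

Theorem theorem1 (R : realType) (n : nat) (x y : 'I_n -> R) :
  (1 <= n)%N ->
  (forall i j : 'I_n, (i < j)%N -> x i < x j) ->
  (forall i j : 'I_n, (i < j)%N -> y i < y j) ->
  (cn n)%:R^-1 * vandermonde x * vandermonde y
      * expR ((\sum_(i < n) x i) * (\sum_(i < n) y i) / n%:R)
    <= \det (expmx x y)
  /\
  \det (expmx x y)
    <= (cn n)%:R^-1 * vandermonde x * vandermonde y
      * expR (\sum_(i < n) x i * y i).
Proof.
case: n x y => // m x y _ xi yi; apply/andP/exp_det_bounds => i j ij; apply/ltW.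
  exact: xi.
exact: yi.
Qed.
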